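(* For every homeomorphism $\varphi:[0,\infty)\to[0,\infty)$ with $\varphi(t)\ge t$ for all $t$, there is a homeomorphism $\varphi_1:[0,\infty)\to[0,\infty)$ with $\varphi_1(t)\ge t$ for all $t$, depending only on $\varphi$, with the following property. Let $E$ and $E'$ be real Banach spaces of dimension at least $2$, let $D\subset E$ and $D'\subset E'$ be domains (with $D'\ne E'$ if $D\neq E$), and let $f:D\to D'$ be a homeomorphism. Suppose that for every subdomain $D_1\subset D$ (with $D_1\neq E$ if $D=E$), writing $D_1'=f(D_1)$, we have $$\varphi^{-1}\big(j_{D_1}(x,y)\big)\le j_{D_1'}(f(x),f(y))\le \varphi\big(j_{D_1}(x,y)\big)\qquad\text{for all } x,y\in D_1.$$ Then $f$ is $\varphi_1$-FQC.
   Context: A domain is a nonempty open connected set. The norm of a Banach space is written $|\cdot|$. For a domain $D\subsetneq E$ and $z\in D$, $d_D(z)$ is the distance from $z$ to the boundary $\partial D$. The metric $j_D$: for a domain $D\subsetneq E$ and $z_1,z_2\in D$, $$j_D(z_1,z_2)=\log\Big(1+\frac{|z_1-z_2|}{\min\{d_D(z_1),d_D(z_2)\}}\Big).$$ Quasihyperbolic metric: for a domain $D\subsetneq E$ and a rectifiable arc $\alpha\subset D$, the quasihyperbolic length is $\ell_k(\alpha)=\int_\alpha \frac{|dz|}{d_D(z)}$, and for $z_1,z_2\in D$, $k_D(z_1,z_2)=\inf \ell_k(\alpha)$, the infimum being over all rectifiable arcs $\alpha$ in $D$ joining $z_1$ to $z_2$. Solid and FQC maps: let $\varphi:[0,\infty)\to[0,\infty)$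 be a homeomorphism with $\varphi(t)\ge t$ (a growth function). For domains $G\subsetneq E$, $G'\subsetneq E'$, a homeomorphism $g:G\to G'$ is $\varphi$-semisolid if $k_{G'}(g(x),g(y))\le\varphi(k_G(x,y))$ for all $x,y\in G$, and $\varphi$-solid if both $g$ and $g^{-1}$ are $\varphi$-semisolid. A homeomorphism $f:D\to D'$ is freely $\varphi$-quasiconformal ($\varphi$-FQC), also called fully $\varphi$-solid, if for every subdomain $D_1\subset D$ the restriction $f|_{D_1}:D_1\to f(D_1)$ is $\varphi$-solid; here $D_1=D$ is included when $D\ne E$, while only proper subdomains are considered when $D=E$. *)

(* Defs.v *)
From HB Require Import structures.
From mathcomp Require Import all_boot all_order all_algebra.
From mathcomp Require Import all_classical all_reals all_analysis.

Set Implicit Arguments.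
Unset Strict Implicit.
Unset Printing Implicit Defensive.
Import Order.TTheory GRing.Theory Num.Theory.
Import numFieldNormedType.Exports.
Local Open Scope classical_set_scope.
Local Open Scope ring_scope.

(* Maps between subsets are total functions restricted to the subset, and
   [pinv A f] is the inverse of [f] restricted to [A]. *)
Definition homeo_on (T U : ptopologicalType) (A : set T) (B : set U)
    (f : T -> U) : Prop :=
  [/\ set_bij A B f, {within A, continuous f}
    & {within B, continuous (pinv A f)}].

Definition growth_function (R : realType) (phi : R -> R) : Prop :=
  @homeo_on R R `[0, +oo[ `[0, +oo[ phi /\ (forall t, 0 <= t -> t <= phi t).

Definition growth_inv (R : realType) (phi : R -> R) : R -> R :=
  pinv (`[0, +oo[ : set R) phi.

Definition dim_ge2 (R : realType) (E : normedModType R) : Prop :=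
  exists u v : E, forall a b : R, a *: u + b *: v = 0 -> a = 0 /\ b = 0.

Section Metrics.
Context {R : realType} {E : normedModType R}.
Implicit Types (D : set E) (x y z : E) (c : R -> E) (a b : R).

Definition domain D : Prop := [/\ D !=set0, open D & connected D].

Definition frontier D : set E := closure D `\` interior D.

(* The frontier is nonempty for a domain different from the whole space. *)
Definition bdist D z : R := inf [set `|z - w| | w in frontier D].

Definition jmetric D x y : R :=
  ln (1 + `|x - y| / Num.min (bdist D x) (bdist D y)).

Definition curve_variation a b c (s : seq R) : R :=
  let F := c \o nth b (a :: s) in
  \sum_(0 <= n < size s) `|F n.+1 - F n|.

Definition curve_length a b c : \bar R :=
  ereal_sup [set (curve_variation a b c s)%:E | s in itv_partition a b].

(* An arc is the injective continuous image of [a, b]; the one-point arc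
   a = b is allowed, so that a point is joined to itself. *)
Definition rectifiable_arc D x y a b c : Prop :=
  [/\ a <= b,
      {within `[a, b], continuous c} /\ {in `[a, b] &, injective c},
      (forall t, t \in `[a, b] -> D (c t)),
      c a = x /\ c b = y
    & (curve_length a b c < +oo)%E].

(* On a rectifiable arc, t |-> length of c on [a, t] is a strictly increasing
   bijection from [a, b] to [0, length of c]. *)
Definition arclength_param a b c : R -> E :=
  c \o pinv (`[a, b] : set R) (fun t => fine (curve_length a t c)).

Definition qh_length D a b c : \bar R :=
  (\int[@lebesgue_measure R]_(u in `[0%R, fine (curve_length a b c)])
     ((bdist D (arclength_param a b c u))^-1)%:E)%E.

(* The infimum is finite whenever D is a domain different from the whole
   space and x, y belong to D. *)
Definition qh_metric D x y : R :=
  fine (ereal_inf [set l : \bar R | exists a b c,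
    rectifiable_arc D x y a b c /\ l = qh_length D a b c]).

End Metrics.

Definition semisolid (R : realType) (E F : normedModType R) (phi : R -> R)
    (G : set E) (G' : set F) (g : E -> F) : Prop :=
  forall x y, G x -> G y ->
    qh_metric G' (g x) (g y) <= phi (qh_metric G x y).

Definition solid (R : realType) (E F : normedModType R) (phi : R -> R)
    (G : set E) (G' : set F) (g : E -> F) : Prop :=
  [/\ domain G /\ G <> setT, domain G' /\ G' <> setT, homeo_on G G' g,
      semisolid phi G G' g
    & semisolid phi G' G (pinv G g)].

(* If D is not the whole space, the side condition on D1 is void. *)
Definition FQC (R : realType) (E F : normedModType R) (phi : R -> R)
    (D : set E) (D' : set F) (f : E -> F) : Prop :=
  homeo_on D D' f /\
  forall D1 : set E, domain D1 -> D1 `<=` D -> (D = setT -> D1 <> setT) ->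
    solid phi D1 (f @` D1) f.

(* Main.v *)
(* The distance ratio metric j and the quasihyperbolic metric k are comparable
   at small scales: k(x, y) < 1/4 forces j(x, y) <= 4 k(x, y), and
   |x - y| <= d(x)/2 gives k(x, y) <= 2 |x - y| / d(x) along a segment. Hence the
   bounds on j in D1 control k' when k is small. When k(x, y) is large, cut an
   almost minimal arc into O(k) steps with |x_i - x_{i+1}| <= delta d(x_i); each
   image step costs at most 1 in k', so k' <= C k. The hypothesis is symmetric in
   f and its inverse, since phi^-1(j) <= j' means j <= phi(j'). Because k is an
   infimum over injective arcs, joining the image points by segments needs loop
   erasure. *)
Require Import Defs.
From HB Require Import structures.
From mathcomp Require Import all_boot all_order all_algebra.
From mathcomp Require Import all_classical all_reals all_analysis.
From mathcomp Require Import measurable_realfun ring lra.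
Set Implicit Arguments.
Unset Strict Implicit.
Unset Printing Implicit Defensive.
Import Order.TTheory GRing.Theory Num.Theory.
Import numFieldNormedType.Exports.
Local Open Scope classical_set_scope.
Local Open Scope ring_scope.

(** The constants come from [eta], the number with phi(eta) = 1/4. A pair with j <= [eta] has images
    with j' <= 1/4, which is where j' controls |f(x) - f(y)| / d'(f(x)) linearly and where the
    segment from f(x) to f(y) stays in the image domain. Steps with delta = [eta / 2] have j <=
    [eta]. Counting steps never gives a bound below 1, so it cannot force k' to 0 with k. Hence
    phi1(t) = 4 phi(4t) + (8/eta) t: the first term serves k <= eta/4, the second the larger k. The
    linear term has slope at least 1, which makes phi1 an expanding map and so a homeomorphism with
    phi1(t) >= t. Upper bounds on k' do not pass through a triangle inequality for k': one explicit
    arc is extended step by step while its cost accumulates. These arcs carry unit speed, so that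
    the quasihyperbolic length, defined through an inverse of the length function, becomes a plain
    integral. *)

Lemma within_continuousP {R : realType} {T U : normedModType R} (A : set T) (f : T -> U) :
  {within A, continuous f} <->
  forall x, A x -> forall e : R, 0 < e -> exists2 d : R, 0 < d &
    forall y, A y -> `|x - y| < d -> `|f x - f y| < e.
Proof.
rewrite subspace_continuousP; split => [fc x Ax e e0|fc x Ax].
  have /cvgrPdist_lt/(_ e e0) := fc x Ax.
  rewrite /prop_near1 /within /= => /nbhs_ballP[d /= d0 dP].
  by exists d => // y Ay xy; apply: dP => //; rewrite -ball_normE.
apply/cvgrPdist_lt => e e0; have [d d0 dP] := fc x Ax e e0.
rewrite /prop_near1 /within /=; apply/nbhs_ballP; exists d => // y; rewrite -ball_normE => xy Ay.
exact: dP.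
Qed.

(** * Arc length in a normed space *)

Section CurveLength.
Context {R : realType} {E : normedModType R}.
Implicit Types (a b m t u : R) (c : R -> E) (s : seq R).

Lemma curve_variation_nil a b c : curve_variation a b c [::] = 0.
Proof. by rewrite /curve_variation big_geq. Qed.

Lemma curve_variation_cons a b c x s :
  curve_variation a b c (x :: s) = `|c x - c a| + curve_variation x b c s.
Proof. by rewrite /curve_variation /= big_nat_recl. Qed.

Lemma curve_variation_cat a b m c s s' :
  itv_partition a m s ->
  curve_variation a b c (s ++ s') =
    curve_variation a m c s + curve_variation m b c s'.
Proof.
elim: s a => [|x s IH] a ps.
  by rewrite (itv_partition_nil ps) curve_variation_nil add0r.
by rewrite /= !curve_variation_cons IH ?addrA//; exact: itv_partition_cons ps.
Qed.

Lemma eq_curve_variation a b c c' s : itv_partition a b s ->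
  {in `[a, b], c =1 c'} ->
  curve_variation a b c s = curve_variation a b c' s.
Proof.
elim: s a => [|x s IH] a ps cc'; first by rewrite !curve_variation_nil.
have pxs := itv_partition_cons ps.
have xb := itv_partition_le pxs.
have ax : a < x by case: ps => /= /andP[].
rewrite !curve_variation_cons IH//; last first.
  move=> t /[!in_itv]/= /andP[xt tb]; apply: cc'; rewrite in_itv/= tb andbT.
  exact: le_trans (ltW ax) xt.
by rewrite !cc'// in_itv/= ?lexx ?(ltW ax) ?xb// (le_trans (ltW ax)).
Qed.

Lemma curve_variation_ge0 a b c s : 0 <= curve_variation a b c s.
Proof. exact: sumr_ge0. Qed.

Lemma itv_partition_trivial a b : a <= b -> exists s, itv_partition a b s.
Proof.
rewrite le_eqVlt => /predU1P[->|ab]; first by exists [::].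
by exists [:: b]; exact: itv_partition1.
Qed.

Lemma curve_variation_le_length a b c s : itv_partition a b s ->
  ((curve_variation a b c s)%:E <= curve_length a b c)%E.
Proof. by move=> ps; apply: ereal_sup_ubound; exists s. Qed.

Lemma curve_length_ge0 a b c : a <= b -> (0 <= curve_length a b c)%E.
Proof.
move=> /itv_partition_trivial[s ps].
by apply: (le_trans _ (curve_variation_le_length c ps)); rewrite lee_fin curve_variation_ge0.
Qed.

(** Partitions are strictly increasing and omit their left end, so [t] is prepended only when
    [a < t]; for [a = t] the extra term is 0. *)
Lemma itv_partition_step a t b s : a <= t -> t <= b -> itv_partition t b s ->
  exists s', itv_partition a b s' /\ forall c : R -> E,
    curve_variation a b c s' = `|c t - c a| + curve_variation t b c s.
Proof.
rewrite le_eqVlt => /predU1P[->|at_] tb ps.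
  by exists s; split => // c; rewrite subrr normr0 add0r.
exists (t :: s); split => [|c]; last exact: curve_variation_cons.
by case: ps => ? ?; split => //=; rewrite at_.
Qed.

(** Inserting [m] into the partition can only increase the variation, by the triangle inequality on
    the one interval that contains [m]. *)
Lemma curve_variation_split a m b c s : a <= m -> m <= b ->
  itv_partition a b s -> exists s1 s2,
  [/\ itv_partition a m s1, itv_partition m b s2 &
    curve_variation a b c s <= curve_variation a m c s1 + curve_variation m b c s2].
Proof.
elim: s a => [|x s IH] a am mb ps.
  have ab := itv_partition_nil ps.
  have ma : m = a by apply/le_anti; rewrite am ab mb.
  by exists [::], [::]; rewrite ma !curve_variation_nil addr0; split.
have pxs := itv_partition_cons ps.
have ax : a < x by case: ps => /= /andP[].
have [mx|xm] := leP m x.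
  have pmm : itv_partition m m [::] by split => /=.
  have [s1 [ps1 s1E]] := itv_partition_step am (lexx m) pmm.
  have [s2 [ps2 s2E]] := itv_partition_step mx (itv_partition_le pxs) pxs.
  exists s1, s2; split => //.
  rewrite curve_variation_cons s1E s2E curve_variation_nil addr0 addrA lerD2r.
  by rewrite [leRHS]addrC -[X in `|X|](subrKA (c m)) ler_normD.
have [s1 [s2 [ps1 ps2 s12]]] := IH x (ltW xm) mb pxs.
exists (x :: s1), s2; split => //.
  by case: ps1 => ? ?; split => //=; rewrite ax.
by rewrite !curve_variation_cons -addrA lerD2l.
Qed.

Lemma curve_variation_add_le a m b c s s' :
  itv_partition a m s -> itv_partition m b s' ->
  ((curve_variation a m c s + curve_variation m b c s')%:E <= curve_length a b c)%E.
Proof.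
move=> ps ps'; rewrite -(curve_variation_cat b c s' ps).
exact: curve_variation_le_length (itv_partition_cat ps ps').
Qed.

Lemma curve_length_fin_num a b c : a <= b ->
  (curve_length a b c < +oo)%E -> curve_length a b c \is a fin_num.
Proof. by move=> ab fL; rewrite ge0_fin_numE// curve_length_ge0. Qed.

Lemma curve_lengthD a m b c : a <= m -> m <= b ->
  (curve_length a b c < +oo)%E ->
  curve_length a b c = (curve_length a m c + curve_length m b c)%E.
Proof.
move=> am mb fL; apply/eqP; rewrite eq_le; apply/andP; split.
  apply: ge_ereal_sup => _ [s ps <-].
  have [s1 [s2 [ps1 ps2 s12]]] := curve_variation_split c am mb ps.
  apply: (@le_trans _ _ (curve_variation a m c s1 + curve_variation m b c s2)%:E).
    by rewrite lee_fin.
  by rewrite EFinD leeD// curve_variation_le_length.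
(* For the reverse inequality the two suprema are taken one after the other; moving a term across
   the inequality requires it to be finite. *)
have [s0 ps0] := itv_partition_trivial mb.
have fam : curve_length a m c \is a fin_num.
  apply: curve_length_fin_num => //; apply: (le_lt_trans _ fL).
  apply: ge_ereal_sup => _ [s ps <-]; apply: le_trans (curve_variation_add_le c ps ps0).
  by rewrite lee_fin lerDl curve_variation_ge0.
rewrite -leeBrDl//; apply: ge_ereal_sup => _ [s2 ps2 <-].
rewrite leeBrDr// addeC -leeBrDr//; apply: ge_ereal_sup => _ [s1 ps1 <-].
by rewrite leeBrDr// -EFinD curve_variation_add_le.
Qed.

Lemma curve_length_sub a m n b c : a <= m -> m <= n -> n <= b ->
  (curve_length a b c < +oo)%E -> (curve_length m n c < +oo)%E.
Proof.
move=> am mn nb fL; have mb := le_trans mn nb.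
have fmb : (curve_length m b c < +oo)%E.
  apply: (le_lt_trans _ fL); rewrite (curve_lengthD am mb fL).
  by rewrite leeDr// curve_length_ge0.
apply: (le_lt_trans _ fmb); rewrite (curve_lengthD mn nb fmb).
by rewrite leeDl// curve_length_ge0.
Qed.

Section FiniteLength.
Variables (a b : R) (c : R -> E).
Hypotheses (ab : a <= b) (fL : (curve_length a b c < +oo)%E).

Let len (s : R) t := fine (curve_length s t c).

Let lenE (s : R) t : a <= s -> s <= t -> t <= b -> curve_length s t c = (len s t)%:E.
Proof.
by move=> as_ st tb; rewrite fineK// curve_length_fin_num// (curve_length_sub _ _ _ fL).
Qed.

Lemma curve_arclengthD (s : R) t u : a <= s -> s <= t -> t <= u -> u <= b ->
  len s u = len s t + len t u.
Proof.
move=> as_ st tu ub; have su := le_trans st tu.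
apply: EFin_inj; rewrite EFinD -!lenE// ?(le_trans st)// ?(le_trans as_)// ?(le_trans tu)//.
exact: curve_lengthD (curve_length_sub as_ su ub fL).
Qed.

Lemma curve_arclength_ge (s : R) t : a <= s -> s <= t -> t <= b -> `|c t - c s| <= len s t.
Proof.
move=> as_ st tb; rewrite -lee_fin -lenE//; move: st.
rewrite le_eqVlt => /predU1P[->|st].
  by rewrite subrr normr0 curve_length_ge0.
apply: le_trans (curve_variation_le_length c (itv_partition1 st)).
by rewrite lee_fin curve_variation_cons curve_variation_nil addr0.
Qed.

Lemma curve_arclength_ge0 (s : R) t : s <= t -> 0 <= len s t.
Proof. by move=> st; apply: fine_ge0; exact: curve_length_ge0. Qed.

Lemma curve_arclength_xx (s : R) : len s s = 0.
Proof.
rewrite /len; suff -> : curve_length s s c = 0%E by [].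
apply/eqP; rewrite eq_le curve_length_ge0 ?andbT//.
by apply: ge_ereal_sup => _ [r /itv_partitionxx-> <-]; rewrite curve_variation_nil.
Qed.

Let adherent (s : R) t e : a <= s -> s < t -> t <= b -> 0 < e ->
  exists2 p, itv_partition s t p & len s t - e < curve_variation s t c p.
Proof.
move=> as_ st tb e0; have st' := ltW st.
have fst_ : curve_length s t c \is a fin_num by rewrite lenE.
have [_ [p pp <-]] := ub_ereal_sup_adherent e0 fst_.
rewrite -/(curve_length s t c) lenE// -EFinB lte_fin => plt.
by exists p.
Qed.

Hypothesis cc : {within `[a, b], continuous c}.

Let ccP t e : a <= t <= b -> 0 < e ->
  exists2 d, 0 < d & forall r, a <= r <= b -> `|t - r| < d -> `|c t - c r| < e.
Proof.
move=> tab e0; have [d d0 dP] := (within_continuousP _ _).1 cc t tab e e0.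
by exists d => // r rab; apply: dP; rewrite /= in_itv.
Qed.

(** Left continuity of length. Let [q, t] be the last interval of a partition of [a, t] whose
    variation is within e/2 of the length. Then len(q, t) < |c t - c q| + e/2, while |c t - c q| <=
    |c t - c r| + len(q, r); continuity of [c] puts |c t - c r| below e/2 for some r in (q, t), so
    len(r, t) < e. *)
Lemma curve_arclength_left t e : a < t -> t <= b -> 0 < e ->
  exists r, [/\ a <= r, r < t & len r t < e].
Proof.
move=> at_ tb e0; have e20 : 0 < e / 2 by rewrite divr_gt0.
have [p pp] := adherent (lexx a) at_ tb e20.
case/lastP: p pp => [/itv_partition_nil ea|p x pp].
  by move: at_; rewrite ea ltxx.
have [xt pq] : x = t /\ itv_partition a (last a p) p.
  case: pp; rewrite last_rcons rcons_path => /andP[pp _] /eqP ->.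
  by split => //; split.
subst x; set q := last a p in pq *.
have qt : q < t by case: pp; rewrite rcons_path => /andP[_].
have aq := itv_partition_le pq.
rewrite -cats1 (curve_variation_cat t c [:: t] pq) curve_variation_cons curve_variation_nil addr0.
move=> lt_.
have tab : a <= t <= b by rewrite (ltW at_).
have [d d0 dP] := ccP tab e20.
pose r := Num.max ((q + t) / 2) (t - d / 2).
have qr : q < r by rewrite lt_max midf_lt.
have rt : r < t by rewrite gt_max midf_lt// ltrBlDr ltrDl divr_gt0.
have ar : a <= r by rewrite (le_trans aq)// ltW.
have rb : r <= b by rewrite (le_trans (ltW rt)).
exists r; split=> //.
have ctr : `|c t - c r| < e / 2.
  apply: dP; first by rewrite ar.
  rewrite gtr0_norm ?subr_gt0// ltrBlDr -ltrBlDl lt_max; apply/orP; right.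
  by rewrite ltrD2l ltrN2 gtr_pMr// invf_lt1// ltr1n.
have q_b : q <= b by rewrite (le_trans (ltW qt)).
have h1 : curve_variation a q c p <= len a q.
  by rewrite -lee_fin -lenE// curve_variation_le_length.
have h2 : `|c r - c q| <= len q r by apply: curve_arclength_ge => //; exact: ltW.
have h3 : `|c t - c q| <= `|c t - c r| + `|c r - c q|.
  by rewrite -[X in `|X| <= _](subrKA (c r)) ler_normD.
have h4 := curve_arclengthD (lexx a) aq (ltW (lt_trans qr rt)) tb.
have h5 := curve_arclengthD aq (ltW qr) (ltW rt) tb.
lra.
Qed.

Lemma curve_arclength_right t e : a <= t -> t < b -> 0 < e ->
  exists r, [/\ t < r, r <= b & len t r < e].
Proof.
move=> at_ tb e0; have e20 : 0 < e / 2 by rewrite divr_gt0.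
have [p pp] := adherent at_ tb (lexx b) e20.
case: p pp => [/itv_partition_nil ea|q p pp].
  by move: tb; rewrite ea ltxx.
have pq := itv_partition_cons pp.
have tq : t < q by case: pp => /= /andP[].
have qb := itv_partition_le pq.
rewrite curve_variation_cons => lt_.
have tab : a <= t <= b by rewrite at_ ltW.
have [d d0 dP] := ccP tab e20.
pose r := Num.min ((t + q) / 2) (t + d / 2).
have rq : r < q by rewrite gt_min midf_lt.
have tr : t < r by rewrite lt_min midf_lt//= ltrDl divr_gt0.
have rb : r <= b by rewrite (le_trans (ltW rq)).
have ar : a <= r by rewrite (le_trans at_)// ltW.
exists r; split=> //.
have ctr : `|c t - c r| < e / 2.
  apply: dP; first by rewrite ar.
  rewrite distrC gtr0_norm ?subr_gt0// ltrBlDl gt_min; apply/orP; right.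
  by rewrite ltrD2l gtr_pMr// invf_lt1// ltr1n.
have aq : a <= q by rewrite (le_trans ar)// ltW.
have h1 : curve_variation q b c p <= len q b.
  by rewrite -lee_fin -lenE// curve_variation_le_length.
have h2 : `|c q - c r| <= len r q by apply: curve_arclength_ge => //; exact: ltW.
have h3 : `|c q - c t| <= `|c q - c r| + `|c t - c r|.
  by rewrite (distrC (c t)) -[X in `|X| <= _](subrKA (c r)) ler_normD.
have h4 := curve_arclengthD at_ (ltW (lt_trans tr rq)) qb (lexx b).
have h5 := curve_arclengthD at_ (ltW tr) (ltW rq) qb.
lra.
Qed.

(** Intermediate values: at the supremum of the times with length at most [u], left continuity
    excludes a length above [u] and right continuity one below. Surjectivity is what makes [pinv] a
    right inverse of the length function. *)
Lemma curve_arclength_surj : set_surj `[a, b] `[0, len a b] (len a).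
Proof.
move=> u /=; rewrite in_itv/= => /andP[u0 uL].
pose A := [set t | a <= t <= b /\ len a t <= u].
have Aa : A a by split; rewrite ?lexx ?ab// curve_arclength_xx.
have Aub : ubound A b by move=> t [/andP[]].
have hsA : has_sup A by split; [exists a|exists b].
have aT : a <= sup A by apply: ub_le_sup => //; exists b.
have Tb : sup A <= b by apply: ge_sup => //; exists a.
exists (sup A); first by rewrite in_itv/= aT.
apply/eqP; rewrite eq_le; apply/andP; split.
- rewrite leNgt; apply/negP => uT.
  have aT' : a < sup A.
    rewrite lt_neqAle aT andbT; apply/eqP => aE.
    by move: uT; rewrite -aE curve_arclength_xx ltNge u0.
  have e0 : 0 < len a (sup A) - u by rewrite subr_gt0.
  have [r [ar rT lr]] := curve_arclength_left aT' Tb e0.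
  have D1 := curve_arclengthD (lexx a) ar (ltW rT) Tb.
  have /sup_adherent/(_ hsA)[t [/andP[at_ tb] tu]] : 0 < sup A - r by rewrite subr_gt0.
  rewrite subKr => rt.
  have D2 := curve_arclengthD (lexx a) ar (ltW rt) tb.
  have := curve_arclength_ge0 (ltW rt); lra.
- rewrite leNgt; apply/negP => uT.
  have Tb' : sup A < b.
    rewrite lt_neqAle Tb andbT; apply/eqP => TE.
    by move: uT; rewrite TE ltNge uL.
  have e0 : 0 < u - len a (sup A) by rewrite subr_gt0.
  have [r [Tr rb lr]] := curve_arclength_right aT Tb' e0.
  have D1 := curve_arclengthD (lexx a) aT (ltW Tr) rb.
  have : r <= sup A.
    apply: ub_le_sup; first by exists b.
    by split; [rewrite rb (le_trans aT)// ltW|lra].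
  by rewrite leNgt Tr.
Qed.

End FiniteLength.
End CurveLength.

(** * Arclength parametrization of a rectifiable arc *)

Section ArclengthParam.
Context {R : realType} {E : normedModType R}.
Implicit Types (D : set E) (x y z p q : E) (c g : R -> E).

Definition lipschitz1_on (A : set R) g :=
  forall u v, A u -> A v -> `|g u - g v| <= `|u - v|.

Lemma arclength_param_path D x y a b c : rectifiable_arc D x y a b c ->
  exists (L : R) g, [/\ 0 <= L, lipschitz1_on `[0, L] g,
    (forall u, 0 <= u <= L -> D (g u)), g 0 = x /\ g L = y &
    qh_length D a b c = (\int[@lebesgue_measure R]_(u in `[0%R, L]) ((bdist D (g u))^-1)%:E)%E].
Proof.
move=> [ab [cc _] cD [<- <-] fL].
pose len (t : R) := fine (curve_length a t c).
pose L := len b; pose tau := pinv (`[a, b] : set R) len.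
have surj : set_surj `[a, b] `[0, L] len := curve_arclength_surj ab fL cc.
have len_tau u : 0 <= u <= L -> len (tau u) = u.
  by move=> uL; apply: (surjpK _ surj); rewrite inE /= in_itv.
have tau_ab u : 0 <= u <= L -> a <= tau u /\ tau u <= b.
  move=> uL; have : [set` `[a, b]] (tau u).
    by apply: (surjpinv_image_sub surj); exists u; rewrite //= in_itv.
  by rewrite /= in_itv/= => /andP[].
have L0 : 0 <= L by exact: curve_arclength_ge0.
exists L, (arclength_param a b c); split => //.
- move=> u v; rewrite /= !in_itv/= => uL vL; rewrite /arclength_param /= -/len -/tau.
  (* The order is fixed on [tau u], [tau v]; additivity of length then yields [u <= v], and the
     chord is at most the length between, [v - u]. *)
  wlog tuv : u v uL vL / tau u <= tau v.
    move=> W; have [|/ltW] := leP (tau u) (tau v); first exact: W.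
    by rewrite distrC (distrC u); exact: W.
  have [au ub] := tau_ab u uL; have [av vb] := tau_ab v vL.
  have := curve_arclength_ge fL au tuv vb.
  have := curve_arclengthD fL (lexx a) au tuv vb.
  have := curve_arclength_ge0 c tuv.
  rewrite -/(len _) -/(len _) !len_tau// => l0 lD lge.
  rewrite distrC (distrC u) ger0_norm; last by lra.
  by apply: le_trans lge _; lra.
- move=> u uL; rewrite /arclength_param /=; apply: cD; rewrite in_itv/=.
  by have [-> ->] := tau_ab u uL.
split.
  (* The length from [a] to [tau 0] is 0, so [c] takes the same value at both; the end [b] is
     treated alike. *)
  have h0 : 0 <= (0 : R) <= L by rewrite lexx.
  have [a0 b0] := tau_ab 0 h0.
  have := curve_arclength_ge fL (lexx a) a0 b0; rewrite -/(len _) len_tau//.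
  by rewrite normr_le0 subr_eq0 => /eqP.
have hL : 0 <= L <= L by rewrite lexx L0.
have [aL bL] := tau_ab L hL.
have lge := curve_arclength_ge fL aL bL (lexx b).
have := curve_arclengthD fL (lexx a) aL bL (lexx b).
rewrite -/(len _) -/(len _) -/L len_tau// => lD.
have : `|c b - c (tau L)| <= 0 by apply: le_trans lge _; lra.
by rewrite normr_le0 subr_eq0 eq_sym => /eqP.
Qed.

End ArclengthParam.

(** * Distance to the boundary *)

Section BoundaryDistance.
Context {R : realType} {E : normedModType R}.
Implicit Types (D : set E) (x y z w p q : E).

Lemma open_norm_ball D x : open D -> D x ->
  exists2 e : R, 0 < e & forall y, `|x - y| < e -> D y.
Proof.
move=> oD Dx; have /nbhs_ballP[e /= e0 eD] := open_nbhs_nbhs (conj oD Dx).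
by exists e => // y xy; apply: eD; rewrite -ball_normE.
Qed.

Lemma norm_ball_open D :
  (forall x, D x -> exists2 e : R, 0 < e & forall y, `|x - y| < e -> D y) -> open D.
Proof.
move=> DP; rewrite openE => x /DP[e e0 eD]; apply/nbhs_ballP; exists e => // y.
by rewrite -ball_normE; exact: eD.
Qed.

(** The infimum of the times at which the segment from z to w lies outside D gives the point: it is
    outside D because D is open, and in the closure because earlier times lie in D. *)
Lemma frontier_between D z w : open D -> D z -> ~ D w ->
  exists2 p, frontier D p & `|z - p| <= `|z - w|.
Proof.
move=> oD Dz nDw; pose pt (t : R) := z + t *: (w - z).
have ptB s t : pt s - pt t = (s - t) *: (w - z).
  by rewrite /pt opprD addrACA subrr add0r -scalerBl.
pose A := [set t | 0 <= t <= 1 /\ ~ D (pt t)].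
have A1 : A 1 by split; rewrite ?lexx ?ler01// /pt scale1r addrC subrK.
have lbA : lbound A 0 by move=> t [/andP[]].
have hiA : has_inf A by split; [exists 1|exists 0].
have T0 : 0 <= inf A by apply: lb_le_inf => //; exists 1.
have T1 : inf A <= 1 by apply: ge_inf => //; exists 0.
(* The [+ 1] makes [B] positive at once, so that [e / B] serves as a modulus of continuity for
   [pt]. *)
pose B := `|w - z| + 1; have B0 : 0 < B by rewrite ltr_wpDl.
have ptB_lt (s t e : R) : 0 < e -> `|s - t| < e / B -> `|pt s - pt t| < e.
  move=> e0; rewrite ltr_pdivlMr// => st; rewrite ptB normrZ.
  by apply: le_lt_trans st; rewrite ler_wpM2l// lerDl.
have nDT : ~ D (pt (inf A)).
  move=> DT; have [e e0 eD] := open_norm_ball oD DT.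
  have eB0 : 0 < e / B by rewrite divr_gt0.
  have [t At tT] := inf_adherent eB0 hiA.
  have /ge_inf-/(_ _ At) Tt : has_lbound A by exists 0.
  case: At => _; apply; apply: eD; apply: ptB_lt => //.
  by rewrite distrC ger0_norm ?subr_ge0// ltrBlDl.
exists (pt (inf A)); last first.
  have -> : z - pt (inf A) = pt 0 - pt (inf A) by rewrite {2}/pt scale0r addr0.
  rewrite ptB sub0r normrZ normrN ger0_norm// (distrC z).
  by rewrite ler_piMl.
split; last by move/interior_subset.
move=> U /nbhs_ballP[e /= e0 eU].
have eB0 : 0 < e / B by rewrite divr_gt0.
(* A point of D within [e] of the exit point: z itself if the exit time is small, otherwise the
   point half of [e / B] earlier. *)
have [T0'|Te] := leP (inf A) (e / B / 2).
  exists z; split => //; apply: eU; rewrite -ball_normE /=.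
  have -> : z = pt 0 by rewrite /pt scale0r addr0.
  by apply: ptB_lt => //; rewrite subr0 ger0_norm//; lra.
exists (pt (inf A - e / B / 2)); split; last first.
  by apply: eU; rewrite -ball_normE /=; apply: ptB_lt => //; rewrite subKr gtr0_norm; lra.
apply: contrapT => nD.
have : A (inf A - e / B / 2) by split => //; apply/andP; split; lra.
move/ge_inf => /(_ _); have hlb : has_lbound A by exists 0.
by move=> /(_ hlb); lra.
Qed.

Lemma bdist_le D z p : frontier D p -> bdist D z <= `|z - p|.
Proof.
move=> fp; apply: ge_inf; last by exists p.
by exists 0 => _ [w _ <-].
Qed.

Lemma bdist_ball D z w : open D -> D z -> `|z - w| < bdist D z -> D w.
Proof.
move=> oD Dz zw; apply: contrapT => /(frontier_between oD Dz)[p fp zp].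
by have := le_lt_trans (le_trans (bdist_le z fp) zp) zw; rewrite ltxx.
Qed.

Lemma frontier_neq0 D : domain D -> D <> setT -> frontier D !=set0.
Proof.
move=> [[z Dz] oD _] DT.
have [w nDw] : exists w, ~ D w.
  by apply/existsNP => allD; apply: DT; rewrite -subTset => w _; exact: allD.
by have [p fp _] := frontier_between oD Dz nDw; exists p.
Qed.

Lemma bdist_gt0 D z : domain D -> D <> setT -> D z -> 0 < bdist D z.
Proof.
move=> dD DT Dz; have [p0 fp0] := frontier_neq0 dD DT.
have [_ oD _] := dD; have [e e0 eD] := open_norm_ball oD Dz.
apply: (lt_le_trans e0); apply: lb_le_inf; first by exists `|z - p0|, p0.
move=> _ [p [_ np] <-]; rewrite leNgt; apply/negP => /eD Dp.
by apply: np; rewrite ((interior_id _).1 oD).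
Qed.

Lemma bdist_lipschitz D x y : bdist D x <= bdist D y + `|x - y|.
Proof.
(* With an empty frontier both distances take the default value [inf set0 = 0]. *)
have [F0|/set0P/negP/negPn/eqP F0] := pselect (frontier D !=set0); last first.
  by rewrite /bdist F0 !image_set0 inf0 add0r.
rewrite -lerBlDr; apply: lb_le_inf; first by case: F0 => p fp; exists `|y - p|, p.
move=> _ [p fp <-]; rewrite lerBlDr; apply: le_trans (bdist_le x fp) _.
by rewrite [leRHS]addrC ler_distD.
Qed.

Lemma jmetric_ge0 D x y : domain D -> D <> setT -> D x -> D y -> 0 <= jmetric D x y.
Proof.
move=> dD DT Dx Dy; rewrite ln_ge0// lerDl divr_ge0//.
by rewrite le_min !ltW// bdist_gt0.
Qed.

Lemma jmetric_le D x y (r : R) : domain D -> D <> setT -> D x -> D y ->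
  `|x - y| <= r * bdist D x -> `|x - y| <= r * bdist D y -> jmetric D x y <= r.
Proof.
move=> dD DT Dx Dy rx ry.
have m0 : 0 < Num.min (bdist D x) (bdist D y) by rewrite lt_min !bdist_gt0.
have rm : `|x - y| / Num.min (bdist D x) (bdist D y) <= r.
  by rewrite ler_pdivrMr//; case: (leP (bdist D x)).
apply: le_trans rm; rewrite /jmetric; set q := _ / _.
have q0 : 0 <= q by rewrite divr_ge0// ltW.
by rewrite -ler_expR lnK ?expR_ge1Dx// posrE ltr_wpDr.
Qed.

(** With q = |x - y| / min, the bound (1 - j)(1 + q) <= 1 gives q (1 - j) <= j, hence q <= 2 j once
    j <= 1/4. *)
Lemma norm_le_jmetric D x y : domain D -> D <> setT -> D x -> D y ->
  jmetric D x y <= 1 / 4 -> `|x - y| <= 2 * jmetric D x y * bdist D x.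
Proof.
move=> dD DT Dx Dy.
have m0 : 0 < Num.min (bdist D x) (bdist D y) by rewrite lt_min !bdist_gt0.
have j0 := jmetric_ge0 dD DT Dx Dy.
move: j0; rewrite /jmetric; set m := Num.min _ _ in m0 *; set q := `|_| / _; set j := ln _ => j0 j4.
have q0 : 0 <= q by rewrite divr_ge0// ltW.
have q1 : 0 < 1 + q by rewrite ltr_pwDl.
(* [ln (1 + q) >= q / (1 + q)] *)
have : 1 - j <= (1 + q)^-1.
  by have := expR_ge1Dx (- j); rewrite expRN /j lnK ?posrE.
rewrite -(ler_pM2r q1) mulVf ?gt_eqF// => jq.
have qj : q <= 2 * j by nra.
have -> : `|x - y| = q * m by rewrite divfK// gt_eqF.
apply: ler_pM => //; first exact: ltW.
by rewrite ge_min lexx.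
Qed.

End BoundaryDistance.

(** * Chains of short steps along a path *)

Section StepChain.
Context {R : realType} {E : normedModType R}.
Variable D : set E.
Hypotheses (dD : domain D) (DT : D <> setT).
Implicit Types (x y z w p q : E) (g : R -> E).

Lemma measurable_inv_bdist g (A : set R) : measurable A -> lipschitz1_on A g ->
  (forall u, A u -> D (g u)) ->
  measurable_fun A (EFin \o (fun u => (bdist D (g u))^-1)).
Proof.
move=> mA gL gD; apply/measurable_EFinP; apply: subspace_continuous_measurable_fun => //.
have dc : {within A, continuous (fun u => bdist D (g u))}.
  apply/within_continuousP => u Au e e0; exists e => // v Av; apply: le_lt_trans.
  apply: le_trans (gL _ _ Au Av); rewrite ler_norml lerBlDl bdist_lipschitz andbT.
  by rewrite lerBrDl lerBlDr distrC bdist_lipschitz.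
move/subspace_continuousP: dc => dc; apply/subspace_continuousP => u Au.
have := dc u Au; rewrite /from_subspace => dcu; apply: cvgV => //.
by rewrite gt_eqF// bdist_gt0//; exact: gD.
Qed.

(** A step is measured against the boundary distance of its starting point alone. Stationary steps
    are allowed, so a chain that arrives early can be padded to exactly [n] steps. *)
Fixpoint step_chain (delta : R) (n : nat) x y : Prop :=
  if n is n'.+1 then
    exists z, [/\ D z, `|x - z| <= delta * bdist D x & step_chain delta n' z y]
  else x = y.

Lemma step_chain_refl (delta : R) n x : 0 <= delta -> D x -> step_chain delta n x x.
Proof.
move=> d0 Dx; elim: n => //= n IH; exists x; split => //.
by rewrite subrr normr0 mulr_ge0// ltW// bdist_gt0.
Qed.

Let inv_bdist_ge0 z : D z -> (0 <= ((bdist D z)^-1)%:E :> \bar R)%E.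
Proof. by move=> Dz; rewrite lee_fin invr_ge0 ltW// bdist_gt0. Qed.

(** Greedy cutting: from [g u], with b = d(g u), advance the parameter by delta b. There d <= (1 +
    delta) b, so this piece uses at least delta / (1 + delta) of the integral, and an integral below
    n such amounts is exhausted within n steps. *)
Lemma step_chain_of_path (delta L : R) g n u : 0 < delta -> 0 <= u <= L ->
  lipschitz1_on `[0, L] g -> (forall v, 0 <= v <= L -> D (g v)) ->
  (\int[@lebesgue_measure R]_(v in `[u, L[) ((bdist D (g v))^-1)%:E
     < (n%:R * (delta / (1 + delta)))%:E)%E ->
  step_chain delta n (g u) (g L).
Proof.
move=> d0 uL gL gD; elim: n u uL => [|n IH] u uL.
  rewrite mul0r ltNge integral_ge0// => v /=; rewrite in_itv/= => /andP[uv vL].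
  by apply: inv_bdist_ge0; apply: gD; lra.
have Dgu := gD u uL; have b0 := bdist_gt0 dD DT Dgu.
set b := bdist D (g u) in b0 *.
have db0 : 0 < delta * b by rewrite mulr_gt0.
have L0 : 0 <= L by lra.
have uin : (`[0, L]%classic : set R) u by rewrite /= in_itv.
(* If the end is in reach, one step goes there and the remaining ones are stationary. *)
have [Lu|Lu] := leP L (u + delta * b) => /= intu.
  exists (g L); split; first by apply: gD; lra.
    apply: le_trans (gL u L uin _) _; first by rewrite /= in_itv/= lexx L0.
    by rewrite distrC ger0_norm -/b; lra.
  by apply: step_chain_refl; [exact: ltW|apply: gD; lra].
set u' := u + delta * b in Lu.
have u'E : u' = u + delta * b by [].
exists (g u'); have u'in : (`[0, L]%classic : set R) u' by rewrite /= in_itv/=; lra.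
split; first by apply: gD; lra.
  apply: le_trans (gL u u' uin u'in) _.
  by rewrite distrC /u' addrAC subrr add0r gtr0_norm.
apply: IH; first lra.
have msub (I : interval R) : [set` I] `<=` `[0, L] -> measurable_fun [set` I] (EFin \o (fun u => (bdist D (g u))^-1)).
  move=> IL; apply: measurable_inv_bdist => //.
    by move=> v w /IL ? /IL ?; exact: gL.
  by move=> v /IL/=; rewrite in_itv/=; exact: gD.
(* Half-open intervals split disjointly at [u'], so the induction stays on integrals of the same
   shape. *)
have IE : `[u, L[%classic = `[u, u'[%classic `|` `[u', L[%classic.
  apply/seteqP; split => v /=; rewrite !in_itv/=.
    by move=> /andP[uv vL]; case: (ltP v u') => vu'; [left; rewrite uv|right].
  by case=> /andP[h1 h2]; apply/andP; split; lra.
have ge0 v : 0 <= v <= L -> (0 <= ((bdist D (g v))^-1)%:E :> \bar R)%E.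
  by move=> vL; apply: inv_bdist_ge0; exact: gD.
move: intu; rewrite IE ge0_integral_setU//=; last 3 first.
- have := msub `[u, L[; rewrite IE; apply => v.
  by rewrite -IE /= !in_itv/= => /andP[? ?]; lra.
- by move=> v [] /=; rewrite in_itv/= => /andP[? ?]; apply: ge0; lra.
- apply/disj_setPLR => v /=; rewrite !in_itv/= => /andP[_ h] /andP[h' _].
  by move: h; rewrite ltNge h'.
set k := delta / (1 + delta).
have kle : (k%:E <= \int[@lebesgue_measure R]_(v in `[u, u'[) ((bdist D (g v))^-1)%:E)%E.
  have kE : (\int[@lebesgue_measure R]_(v in `[u, u'[) (cst (b * (1 + delta))^-1%:E v) = k%:E)%E.
    rewrite integral_cst//= lebesgue_measure_itv/= lte_fin ltrDl db0 -EFinB -EFinM.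
    congr (_%:E); rewrite /u' /k addrAC subrr add0r; field.
    by rewrite !gt_eqF//; lra.
  rewrite -kE; apply: ge0_le_integral => //.
  - by move=> v _; rewrite lee_fin invr_ge0 mulr_ge0// ?ltW//; lra.
  - by apply: msub => v /=; rewrite !in_itv/= => /andP[? ?]; lra.
  move=> v /=; rewrite in_itv/= => /andP[uv vu'].
  have vL : 0 <= v <= L by lra.
  have dgv := bdist_gt0 dD DT (gD v vL).
  have d1 : 0 < 1 + delta by lra.
  rewrite lee_fin lef_pV2 ?posrE ?mulr_gt0//.
  apply: le_trans (bdist_lipschitz D _ (g u)) _; rewrite -/b mulrDr mulr1 lerD2l.
  have vin : (`[0, L]%classic : set R) v by rewrite /= in_itv/=.
  apply: le_trans (gL v u vin uin) _; rewrite ger0_norm ?subr_ge0//.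
  by rewrite mulrC; rewrite /u' in vu'; lra.
move=> intu; rewrite -(lteD2lE (x := k%:E))//.
apply: le_lt_trans (leeD2r _ kle) _; apply: lt_le_trans intu _.
by rewrite -EFinD lee_fin -natr1; lra.
Qed.

End StepChain.

(** * Injective arcs of controlled quasihyperbolic length *)

Section UnitSpeedArc.
Context {R : realType} {E : normedModType R}.
Variable D : set E.
Hypotheses (dD : domain D) (DT : D <> setT).
Implicit Types (x y z w p q : E) (c : R -> E).

Lemma lipschitz1_onS (A B : set R) c : A `<=` B -> lipschitz1_on B c -> lipschitz1_on A c.
Proof. by move=> AB cL u v /AB ? /AB ?; exact: cL. Qed.

Lemma curve_variation_lipschitz1 (a b : R) c s : itv_partition a b s ->
  lipschitz1_on `[a, b] c -> curve_variation a b c s <= b - a.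
Proof.
elim: s a => [|t s IH] a ps cL.
  by rewrite curve_variation_nil (itv_partition_nil ps) subrr.
have pts := itv_partition_cons ps.
have at_ : a < t by case: ps => /= /andP[].
have tb := itv_partition_le pts.
have -> : b - a = (t - a) + (b - t) by ring.
rewrite curve_variation_cons; apply: lerD; last first.
  apply: IH => //; apply: lipschitz1_onS cL => v /=.
  by rewrite !in_itv/= => /andP[tv ->]; rewrite (le_trans (ltW at_)).
rewrite -[leRHS]gtr0_norm ?subr_gt0//; apply: cL; rewrite /= in_itv/= ?lexx ?tb ?(ltW at_)//.
by rewrite (le_trans (ltW at_)).
Qed.

(** The last clause asks that the length of each initial piece be attained by a partition and equal
    the parameter. Polygonal arcs, the only ones built here, satisfy it; with the Lipschitz bound it
    makes the length on [0, u] exactly [u]. *)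
Definition unit_speed_arc x y (L : R) c : Prop :=
  [/\ 0 <= L /\ (forall u, 0 <= u <= L -> D (c u)), c 0 = x /\ c L = y,
      {in `[0, L] &, injective c}, lipschitz1_on `[0, L] c &
      forall u, 0 <= u <= L ->
        exists2 s, itv_partition 0 u s & curve_variation 0 u c s = u].

Lemma unit_speed_arc_length x y L c u : unit_speed_arc x y L c -> 0 <= u <= L ->
  curve_length 0 u c = u%:E.
Proof.
move=> [_ _ _ cL cV] uL; apply/eqP; rewrite eq_le; apply/andP; split.
  apply: ge_ereal_sup => _ [s ps <-]; rewrite lee_fin -[leRHS]subr0.
  apply: curve_variation_lipschitz1 ps _; apply: lipschitz1_onS cL => v /=.
  by rewrite !in_itv/= => /andP[? ?]; lra.
have [s ps sE] := cV u uL.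
by rewrite -[X in (X%:E <= _)%E]sE curve_variation_le_length.
Qed.

Lemma unit_speed_arc_rectifiable x y L c : unit_speed_arc x y L c ->
  rectifiable_arc D x y 0 L c.
Proof.
move=> uc; have [[L0 cD] cxy ci cL _] := uc.
split => //; last by rewrite (unit_speed_arc_length uc) ?ltry// L0 lexx.
split => //; apply/within_continuousP => u uL e e0; exists e => // v vL.
by apply: le_lt_trans; exact: cL.
Qed.

(** The length function is the identity on [0, L], hence so is its [pinv] there, and the arclength
    parametrization is [c] itself. *)
Lemma unit_speed_arc_qh_length x y L c : unit_speed_arc x y L c ->
  qh_length D 0 L c =
    (\int[@lebesgue_measure R]_(u in `[0%R, L]) ((bdist D (c u))^-1)%:E)%E.
Proof.
move=> uc; have [[L0 cD] cxy ci cL _] := uc.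
have lenE t : 0 <= t <= L -> fine (curve_length 0 t c) = t.
  by move=> tL; rewrite (unit_speed_arc_length uc tL).
rewrite /qh_length lenE ?L0 ?lexx//; apply: eq_integral => u; rewrite inE /= in_itv/= => uL.
suff -> : arclength_param 0 L c u = c u by [].
rewrite /arclength_param /=; congr c; pose len (t : R) := fine (curve_length 0 t c); rewrite -/len.
have surj : set_surj `[0, L] `[0, L] len.
  by move=> v /=; rewrite in_itv/= => vL; exists v; rewrite /= ?in_itv// /len lenE.
have uin : u \in (`[0, L]%classic : set R) by rewrite inE /= in_itv.
have : [set` `[0, L]] (pinv `[0, L] len u).
  by apply: (surjpinv_image_sub surj); exists u; rewrite //= in_itv.
rewrite /= in_itv/= => /lenE; rewrite -/(len _).
by rewrite (surjpK _ surj).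
Qed.

(** A witnessed form of k(x, y) <= M: it keeps the arc, so that the arc can be prolonged. *)
Definition qh_reachable (M : R) x y : Prop := exists L c, unit_speed_arc x y L c /\
  (\int[@lebesgue_measure R]_(u in `[0%R, L]) ((bdist D (c u))^-1)%:E <= M%:E)%E.

Lemma qh_reachable_refl x : D x -> qh_reachable 0 x x.
Proof.
move=> Dx; exists 0, (cst x); split; last first.
  by rewrite set_itv1 integral_set1.
split => //.
- by move=> u v; rewrite !in_itv/= => /le_anti <- /le_anti <-.
- by move=> u v _ _; rewrite subrr normr0.
- by move=> u /le_anti <-; exists [::]; rewrite ?curve_variation_nil.
Qed.

End UnitSpeedArc.

(** * Prolonging an injective arc by a segment *)

Section LoopErasure.
Context {R : realType} {E : normedModType R}.
Variable D : set E.
Hypotheses (dD : domain D) (DT : D <> setT).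
Implicit Types (x y z w p q : E) (c : R -> E).

(** The infimum of the hitting times is itself one: otherwise a ball around [c (inf A)] misses the
    closed set, yet the Lipschitz bound places later hits inside it. *)
Lemma first_hit (L : R) c (S : set E) : closed S -> 0 <= L ->
  lipschitz1_on `[0, L] c -> S (c L) ->
  exists t, [/\ 0 <= t <= L, S (c t) & forall u, 0 <= u < t -> ~ S (c u)].
Proof.
move=> cS L0 cL SL; pose A := [set t | 0 <= t <= L /\ S (c t)].
have AL : A L by split; rewrite ?lexx ?L0.
have lbA : has_lbound A by exists 0 => t [/andP[]].
have hiA : has_inf A by split; [exists L|].
have T0 : 0 <= inf A by apply: lb_le_inf; [exists L|move=> t [/andP[]]].
have TL : inf A <= L by exact: ge_inf.
exists (inf A); split; first by rewrite T0.
  apply: contrapT => nS; have oS : open (~` S) by exact: closed_openC.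
  have [e e0 eS] := open_norm_ball oS nS.
  have [t [/andP[t0 tL] St] te] := inf_adherent e0 hiA.
  have Tt : inf A <= t by apply: ge_inf => //; split; rewrite ?t0.
  have : (~` S) (c t); last exact.
  apply: eS; apply: le_lt_trans (cL _ _ _ _) _; rewrite /= ?in_itv/= ?T0 ?t0//.
  by rewrite distrC ger0_norm ?subr_ge0// ltrBlDl.
move=> u /andP[u0 uT] Su; have : inf A <= u; last by rewrite leNgt uT.
by apply: ge_inf => //; split => //; rewrite u0 (le_trans (ltW uT)).
Qed.

(* Follow [c] up to its first hit with the segment, then the segment: this
   keeps the path injective. *)
Lemma qh_reachable_step M x p q : qh_reachable D M x p ->
  `|p - q| <= bdist D p / 2 ->
  qh_reachable D (M + 2 * `|p - q| / bdist D p) x q.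
Proof.
move=> [L [c [[[L0 cD] [c0 cp] ci cL cV] cM]]] pq.
have Dp : D p by rewrite -cp; apply: cD; rewrite L0 lexx.
have [_ oD _] := dD; have bp0 := bdist_gt0 dD DT Dp.
(* The unit vector [e] below requires [q != p]; when they coincide the arc is kept at cost 0. *)
have [->|pq_neq] := eqVneq q p.
  rewrite subrr normr0 mulr0 mul0r addr0; exists L, c; split => //.
pose l := `|p - q|; have l0 : 0 < l by rewrite normr_gt0 subr_eq0 eq_sym.
pose e := l^-1 *: (q - p).
have e1 : `|e| = 1.
  by rewrite normrZ gtr0_norm ?invr_gt0// distrC mulVf// gt_eqF.
pose seg (s : R) := p + s *: e.
have segB s t : seg s - seg t = (s - t) *: e.
  by rewrite /seg opprD addrACA subrr add0r -scalerBl.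
have segN s t : `|seg s - seg t| = `|s - t| by rewrite segB normrZ e1 mulr1.
have segp : seg 0 = p by rewrite /seg scale0r addr0.
have segq : seg l = q by rewrite /seg scalerA divff ?gt_eqF// scale1r addrC subrK.
have cseg : closed (seg @` `[0, l]).
  apply: compact_closed; first exact: norm_hausdorff.
  apply: continuous_compact; last exact: segment_compact.
  apply/within_continuousP => u _ r r0; exists r => // v _.
  by rewrite segN.
have Sp : (seg @` `[0, l]) (c L).
  by exists 0; rewrite ?segp//= in_itv/= lexx ltW.
have [t [tL [s sl sE] tmin]] := first_hit cseg L0 cL Sp.
move: sl; rewrite /= in_itv/= => sl.
pose L' := t + (l - s).
pose c' u := if u <= t then c u else seg (s + (u - t)).
have c'l u : u <= t -> c' u = c u by rewrite /c' => ->.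
have c'r u : t <= u -> c' u = seg (s + (u - t)).
  rewrite le_eqVlt => /predU1P[<-|tu]; last by rewrite /c' leNgt tu.
  by rewrite c'l// subrr addr0.
(* On the segment d >= d(p) - |p - q| >= d(p) / 2; this is the origin of the factor 2 in the
   cost. *)
have segD r : 0 <= r <= l -> bdist D p / 2 <= bdist D (seg r).
  move=> rl; have := bdist_lipschitz D p (seg r).
  rewrite -{2}segp segN sub0r normrN ger0_norm; last lra.
  by rewrite -/l in pq; lra.
have Dseg r : 0 <= r <= l -> D (seg r).
  move=> rl; apply: (bdist_ball oD Dp).
  rewrite -segp segN segp sub0r normrN ger0_norm; last lra.
  by rewrite -/l in pq; lra.
have L'0 : 0 <= L' by rewrite /L'; lra.
have L'E : L' = t + (l - s) by [].
have c'D u : 0 <= u <= L' -> D (c' u).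
  move=> uL; have [ut|/ltW tu] := leP u t; first by rewrite c'l//; apply: cD; lra.
  by rewrite c'r//; apply: Dseg; lra.
have c'L : lipschitz1_on `[0, L'] c'.
  move=> u v; rewrite /= !in_itv/=; wlog uv : u v / u <= v => [W|] uL vL.
    have [|/ltW] := leP u v => uv; first exact: W.
    by rewrite distrC (distrC u); exact: W.
  have [vt|/ltW tv] := leP v t.
    by rewrite !c'l ?(le_trans uv)//; apply: cL; rewrite /= in_itv/=; lra.
  have [ut|/ltW tu] := leP u t; last first.
    rewrite !c'r// segN opprD addrACA subrr add0r opprB addrA subrK//.
  apply: le_trans (ler_distD (c' t) _ _) _.
  have h1 : `|c' u - c' t| <= t - u.
    rewrite !c'l// -[leRHS]ger0_norm ?subr_ge0// (distrC t).
    by apply: cL; rewrite /= in_itv/=; lra.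
  have h2 : `|c' t - c' v| = v - t.
    by rewrite !c'r// segN subrr addr0 opprD addNKr normrN ger0_norm ?subr_ge0.
  by rewrite h2 (distrC u) ger0_norm ?subr_ge0//; lra.
have c'i : {in `[0, L'] &, injective c'}.
  move=> u v; rewrite !in_itv/=; wlog uv : u v / u <= v => [W|] uL vL uvE.
    by have [|/ltW] := leP u v => uv; [exact: W|apply/esym; exact: W].
  have [vt|tv] := leP v t.
    move: uvE; rewrite !c'l ?(le_trans uv)//; apply: ci; rewrite in_itv/=; lra.
  (* An equality between a point before [t] and one after it would be an earlier hit of the
     segment. *)
  have [ut|tu] := ltP u t.
    exfalso; apply: (tmin u); first by lra.
    rewrite -(c'l u (ltW ut)) uvE c'r ?(ltW tv)//.
    by exists (s + (v - t)); rewrite //= in_itv/=; lra.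
  move: uvE => /eqP; rewrite -subr_eq0 !c'r ?(ltW tv)// -normr_eq0 segN.
  by rewrite normr_eq0 => /eqP; lra.
have c'V u : 0 <= u <= L' ->
    exists2 r, itv_partition 0 u r & curve_variation 0 u c' r = u.
  have c'V0 u' : 0 <= u' <= t ->
      exists2 r, itv_partition 0 u' r & curve_variation 0 u' c' r = u'.
    move=> ut; have [|r pr rE] := cV u'; first by lra.
    exists r => //; rewrite -[RHS]rE; apply: eq_curve_variation pr _ => v.
    by rewrite in_itv/= => vu; rewrite c'l//; lra.
  move=> uL; have [ut|tu] := leP u t; first by apply: c'V0; lra.
  have [|r pr rE] := c'V0 t; first by lra.
  exists (r ++ [:: u]); first by apply: itv_partition_cat pr _; exact: itv_partition1.
  rewrite (curve_variation_cat _ _ _ pr) rE curve_variation_cons curve_variation_nil.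
  rewrite !c'r ?(ltW tu)// segN subrr !addr0 addrAC subrr add0r.
  by rewrite gtr0_norm ?subr_gt0// addrC subrK.
exists L', c'; split.
  split => //; split; first by rewrite c'l//; lra.
  by rewrite c'r; [rewrite -segq; congr seg|]; lra.
have mI (I : interval R) : [set` I] `<=` `[0, L'] ->
    measurable_fun [set` I] (EFin \o (fun u => (bdist D (c' u))^-1)).
  move=> IL; apply: (measurable_inv_bdist dD DT) => //.
    exact: lipschitz1_onS c'L.
  by move=> v /IL/=; rewrite in_itv/=; exact: c'D.
have IE : `[0, L']%classic = `[0, t]%classic `|` `]t, L']%classic.
  apply/seteqP; split => v /=; rewrite !in_itv/=.
    by move=> /andP[uv vL]; case: (leP v t) => vu'; [left; rewrite uv|right].
  by case=> /andP[h1 h2]; apply/andP; split; lra.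
have ge0 v : 0 <= v <= L' -> (0 <= ((bdist D (c' v))^-1)%:E :> \bar R)%E.
  by move=> vL; rewrite lee_fin invr_ge0 ltW// bdist_gt0//; exact: c'D.
rewrite IE ge0_integral_setU//=; last 3 first.
- have := mI `[0, L']; rewrite IE; apply => v.
  by rewrite -IE.
- by move=> v [] /=; rewrite in_itv/= => /andP[? ?]; apply: ge0; lra.
- apply/disj_setPLR => v /=; rewrite !in_itv/= => /andP[_ h] /andP[h' _].
  by move: h'; rewrite ltNge h.
rewrite EFinD leeD//.
  apply: le_trans cM.
  rewrite [leLHS](_ : _ =
      (\int[@lebesgue_measure R]_(u in `[0%R, t]) ((bdist D (c u))^-1)%:E)%E); last first.
    by apply: eq_integral => u; rewrite inE /= in_itv/= => /andP[_ ut]; rewrite c'l.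
  apply: ge0_subset_integral => //.
  - exact: (measurable_inv_bdist dD DT).
  - move=> v /=; rewrite in_itv/= => vL.
    by rewrite lee_fin invr_ge0 ltW// bdist_gt0//; exact: cD.
  by move=> v /=; rewrite !in_itv/=; lra.
apply: (@le_trans _ _ (\int[@lebesgue_measure R]_(v in `]t, L']) (cst (bdist D p / 2)^-1%:E v))%E).
  apply: ge0_le_integral => //.
  - by move=> v /=; rewrite in_itv/= => /andP[? ?]; apply: ge0; lra.
  - by apply: mI => v /=; rewrite !in_itv/= => /andP[? ?]; lra.
  move=> v /=; rewrite in_itv/= => /andP[tv vL].
  have rl : 0 <= s + (v - t) <= l by lra.
  rewrite lee_fin c'r ?(ltW tv)// lef_pV2 ?posrE ?divr_gt0//; first exact: segD.
  by rewrite bdist_gt0//; exact: Dseg.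
rewrite integral_cst//= lebesgue_measure_itv/= lte_fin.
have -> : 2 * l / bdist D p = (bdist D p / 2)^-1 * l by field; rewrite gt_eqF.
have h0 : 0 < (bdist D p / 2)^-1 by rewrite invr_gt0 divr_gt0.
(* The interval is empty when [s = l], that is, when the first hit is already [q]. *)
case: ifPn => _; last by rewrite mule0 lee_fin mulr_ge0// ltW.
by rewrite -EFinB -EFinM lee_fin ler_pM2l//; lra.
Qed.

End LoopErasure.

(** * Comparison of the metrics *)

Section QuasihyperbolicMetric.
Context {R : realType} {E : normedModType R}.
Variable D : set E.
Hypotheses (dD : domain D) (DT : D <> setT).
Implicit Types (x y z w p q : E) (c : R -> E).

Lemma qh_reachable_le M N x y : M <= N -> qh_reachable D M x y -> qh_reachable D N x y.
Proof.
move=> MN [L [c [uc cM]]]; exists L, c; split => //.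
by apply: le_trans cM _; rewrite lee_fin.
Qed.

Lemma qh_reachable_near p q : D p -> `|p - q| <= bdist D p / 2 ->
  qh_reachable D (2 * `|p - q| / bdist D p) p q.
Proof.
move=> Dp pq; rewrite -[X in qh_reachable _ X]add0r.
exact: (qh_reachable_step dD DT (qh_reachable_refl Dp)).
Qed.

(** Connectedness: the points reachable from x form a relatively clopen subset of D. This makes the
    infimum in [qh_metric] finite; on [+oo], [fine] would return 0 and a small value of k would say
    nothing. *)
Lemma qh_reachable_domain x y : D x -> D y -> exists M, qh_reachable D M x y.
Proof.
move=> Dx; have [_ oD cD] := dD.
pose B := [set z | D z /\ exists M, qh_reachable D M x z].
suff BE : B = D by move=> Dy; have [] : B y by rewrite BE.
have near p q : D p -> `|p - q| <= bdist D p / 2 -> (exists M, qh_reachable D M x p) ->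
    exists M, qh_reachable D M x q.
  by move=> Dp pq [M xp]; eexists; exact: (qh_reachable_step dD DT xp pq).
(* Since d(q) >= 3 d(p) / 4, a point within d(p) / 4 of p can also step back to p. This reverse step
   gives relative closedness. *)
have quarter p q : D p -> `|p - q| < bdist D p / 4 -> D q /\ `|q - p| <= bdist D q / 2.
  move=> Dp pq; have bp := bdist_gt0 dD DT Dp.
  split; first by apply: (bdist_ball oD Dp); lra.
  by rewrite distrC; have := bdist_lipschitz D p q; lra.
apply: cD.
- by exists x; split => //; exists 0; exact: qh_reachable_refl.
- exists B; last by apply/seteqP; split=> [z [Dz]|z []//]; split.
  apply: norm_ball_open => z [Dz rz]; have bz := bdist_gt0 dD DT Dz.
  exists (bdist D z / 4); first by rewrite divr_gt0.
  move=> w zw; have [Dw _] := quarter z w Dz zw; split => //.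
  by apply: near rz => //; lra.
exists (~` [set z | D z /\ ~ B z]).
  apply: open_closedC; apply: norm_ball_open => z [Dz nBz].
  have bz := bdist_gt0 dD DT Dz.
  exists (bdist D z / 4); first by rewrite divr_gt0.
  move=> w zw; have [Dw wz] := quarter z w Dz zw; split => // -[_ rw].
  by apply: nBz; split => //; exact: near rw.
apply/seteqP; split => z; first by move=> Bz; split => [|[]//]; case: Bz.
by move=> [Dz nz]; apply: contrapT => nBz; apply: nz.
Qed.

Let qh_lengths x y := [set l : \bar R | exists a b c,
    rectifiable_arc D x y a b c /\ l = qh_length D a b c].

Lemma bdist_ge0 z : 0 <= bdist D z.
Proof.
have [w fw] := frontier_neq0 dD DT.
by apply: lb_le_inf; [exists `|z - w|, w|move=> _ [v _ <-]].
Qed.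

Lemma qh_length_ge0 a b c : (0 <= qh_length D a b c)%E.
Proof. by apply: integral_ge0 => u _; rewrite lee_fin invr_ge0 bdist_ge0. Qed.

Let inf_ge0 x y : (0 <= ereal_inf (qh_lengths x y))%E.
Proof. by apply: le_ereal_inf_tmp => _ [a [b [c [_ ->]]]]; exact: qh_length_ge0. Qed.

Let inf_le M x y : qh_reachable D M x y -> (ereal_inf (qh_lengths x y) <= M%:E)%E.
Proof.
move=> [L [c [uc cM]]]; apply: le_trans cM; apply: ereal_inf_lbound.
exists 0, L, c; split; first exact: unit_speed_arc_rectifiable uc.
by rewrite (unit_speed_arc_qh_length uc).
Qed.

Lemma qh_metric_ge0 x y : 0 <= qh_metric D x y.
Proof. exact: fine_ge0 (inf_ge0 x y). Qed.

Lemma qh_metric_le M x y : qh_reachable D M x y -> qh_metric D x y <= M.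
Proof.
move=> /inf_le le; rewrite -lee_fin fineK// ge0_fin_numE ?inf_ge0//.
exact: le_lt_trans le (ltry _).
Qed.

Lemma qh_metric_arc K x y : D x -> D y -> qh_metric D x y < K ->
  exists a b c, rectifiable_arc D x y a b c /\ (qh_length D a b c < K%:E)%E.
Proof.
move=> Dx Dy; have [M /inf_le le] := qh_reachable_domain Dx Dy.
rewrite -lte_fin fineK; last first.
  by rewrite ge0_fin_numE ?inf_ge0//; exact: le_lt_trans le (ltry _).
by move=> /ereal_inf_lt[_ [a [b [c [rc ->]]]] lt]; exists a, b, c.
Qed.

Lemma step_chain_of_qh_metric (delta : R) n x y : 0 < delta -> D x -> D y ->
  qh_metric D x y < n%:R * (delta / (1 + delta)) -> step_chain D delta n x y.
Proof.
move=> d0 Dx Dy /(qh_metric_arc Dx Dy)[a [b [c [rc]]]].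
have [L [g [L0 gL gD [<- <-] ->]]] := arclength_param_path rc => lt.
apply: (step_chain_of_path dD DT d0 _ gL gD); first by rewrite lexx.
apply: le_lt_trans lt; apply: ge0_subset_integral => //.
- apply: (measurable_inv_bdist dD DT) => //.
- by move=> u _; rewrite lee_fin invr_ge0 bdist_ge0.
- by move=> u /=; rewrite !in_itv/= => /andP[-> /ltW].
Qed.

(** As d(q) >= (1 - delta) d(p) >= d(p) / 2, the distance is at most 2 delta times either boundary
    distance. *)
Lemma jmetric_step (delta : R) p q : 0 <= delta -> delta <= 1 / 2 -> D p -> D q ->
  `|p - q| <= delta * bdist D p -> jmetric D p q <= 2 * delta.
Proof.
move=> d0 d2 Dp Dq pq; have bp := bdist_gt0 dD DT Dp.
have bl := bdist_lipschitz D p q.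
have db : delta * bdist D p <= 1 / 2 * bdist D p by rewrite ler_wpM2r// ltW.
have dq : delta * (bdist D p / 2) <= delta * bdist D q by rewrite ler_wpM2l//; lra.
have dp : 0 <= delta * bdist D p by rewrite mulr_ge0// ltW.
by apply: jmetric_le => //; lra.
Qed.

Lemma jmetric_le_qh_metric x y : D x -> D y -> qh_metric D x y < 1 / 4 ->
  jmetric D x y <= 4 * qh_metric D x y.
Proof.
move=> Dx Dy; have := qh_metric_ge0 x y.
set k := qh_metric D x y => k0 k4; rewrite leNgt; apply/negP => jk.
(* If j > 4k, there is room for [delta] strictly between 2k and j/2. With [delta <= 1/2] this gives
   k < delta / (1 + delta), so a single step joins x to y and j <= 2 delta < j. *)
pose delta := Num.min (1 / 2) ((2 * k + jmetric D x y / 2) / 2).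
have d2 : delta <= 1 / 2 by rewrite ge_min lexx.
have dk : 2 * k < delta by rewrite lt_min; apply/andP; split; lra.
have dj : delta < jmetric D x y / 2 by rewrite gt_min; apply/orP; right; lra.
have d0 : 0 < delta by lra.
have : k < 1%:R * (delta / (1 + delta)).
  by rewrite mul1r ltr_pdivlMr; nra.
move/(step_chain_of_qh_metric d0 Dx Dy) => /= [z [Dz xz zy]].
rewrite zy in xz; have := jmetric_step (ltW d0) d2 Dx Dy xz; lra.
Qed.

End QuasihyperbolicMetric.

(** * From a bound on j to semisolidity *)

Section Semisolid.
Context {R : realType} {E F : normedModType R}.
Variables (G : set E) (G' : set F) (g : E -> F) (phi : R -> R) (eta : R).
Hypotheses (dG : domain G) (GT : G <> setT) (dG' : domain G') (GT' : G' <> setT).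
Hypothesis gG : forall x, G x -> G' (g x).
Hypothesis phi_le : forall s t, 0 <= s -> s <= t -> phi s <= phi t.
Hypothesis phi_ge0 : forall t, 0 <= t -> 0 <= phi t.
Hypotheses (eta0 : 0 < eta) (eta4 : eta <= 1 / 4) (phi_eta : phi eta <= 1 / 4).
Hypothesis gj : forall x y, G x -> G y ->
  jmetric G' (g x) (g y) <= phi (jmetric G x y).

(** Here j' <= phi(eta) <= 1/4, so |g p - g q| <= 2 j' d' <= d' / 2, and the cost of the image
    segment is at most 4 j' <= 4 phi(j). *)
Let near_image p q : G p -> G q -> jmetric G p q <= eta ->
  `|g p - g q| <= bdist G' (g p) / 2 /\
  2 * `|g p - g q| / bdist G' (g p) <= 4 * phi (jmetric G p q).
Proof.
move=> Gp Gq pq; have j0 := jmetric_ge0 dG GT Gp Gq.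
have j4 : jmetric G' (g p) (g q) <= 1 / 4.
  by apply: le_trans (gj Gp Gq) _; apply: le_trans phi_eta; exact: phi_le.
have b0 := bdist_gt0 dG' GT' (gG Gp).
have := norm_le_jmetric dG' GT' (gG Gp) (gG Gq) j4.
have := gj Gp Gq; move=> jphi le; split; first by nra.
by rewrite ler_pdivrMr//; nra.
Qed.

(** The start [w] and cost [M] are arbitrary because each image step prolongs the arc at its far
    end. *)
Lemma step_chain_image n p q w M : G p -> step_chain G (eta / 2) n p q ->
  qh_reachable G' M w (g p) -> qh_reachable G' (M + n%:R) w (g q).
Proof.
have e0 := eta0; have e4 := eta4.
elim: n p M => [|n IH] p M Gp /=; first by move=> <-; rewrite addr0.
move=> [z [Gz pz zq]] wp; rewrite -natr1 [n%:R + 1]addrC addrA; apply: IH zq _ => //.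
have pzj : jmetric G p z <= eta.
  have e2 : 0 <= eta / 2 by lra.
  have e2' : eta / 2 <= 1 / 2 by lra.
  by have := jmetric_step dG GT e2 e2' Gp Gz pz; lra.
have [near _] := near_image Gp Gz pzj.
apply: qh_reachable_le (qh_reachable_step dG' GT' wp near).
rewrite lerD2l ler_pdivrMr ?mul1r; first by lra.
exact: bdist_gt0 (gG Gp).
Qed.

Lemma semisolid_of_jmetric :
  semisolid (fun t => 4 * phi (4 * t) + 8 / eta * t) G G' g.
Proof.
have e0 := eta0; have e4 := eta4.
move=> x y Gx Gy; have := qh_metric_ge0 dG GT x y.
set k := qh_metric G x y => k0.
(* Below this threshold j <= 4k <= [eta], so x and y form a near pair. *)
have [ke|ke] := leP k (eta / 4).
  have jk : jmetric G x y <= 4 * k by apply: (jmetric_le_qh_metric dG GT) => //; rewrite -/k; lra.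
  have [|near le] := near_image Gx Gy; first by lra.
  apply: le_trans (qh_metric_le dG' GT' (qh_reachable_near dG' GT' (gG Gx) near)) _.
  apply: le_trans le _; apply: ler_wpDr; first by rewrite mulr_ge0// divr_ge0// ltW.
  by rewrite ler_pM2l//; apply: phi_le => //; exact: jmetric_ge0.
pose kappa := eta / 2 / (1 + eta / 2).
have kappa0 : 0 < kappa by rewrite divr_gt0; lra.
(* Truncation plus one: the chain lemma asks for a strict inequality. *)
have [n kn nk] : exists2 n : nat, k < n%:R * kappa & n%:R <= k / kappa + 1.
  have kk : 0 <= k / kappa by rewrite divr_ge0// ltW.
  exists (Num.truncn (k / kappa)).+1; have /andP[tle tlt] := truncn_itv kk.
    by rewrite -ltr_pdivrMr.
  by rewrite -natr1 lerD2r.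
have e2 : 0 < eta / 2 by lra.
have ch := step_chain_of_qh_metric dG GT e2 Gx Gy kn.
have := step_chain_image Gx ch (qh_reachable_refl (gG Gx)).
rewrite add0r => /(qh_metric_le dG' GT') le.
apply: le_trans le _; apply: le_trans nk _.
apply: ler_wpDl; first by rewrite mulr_ge0// phi_ge0// mulr_ge0.
have -> : k / kappa + 1 = k * (1 + 2 / eta) + 1.
  by rewrite /kappa; field; rewrite !gt_eqF//; lra.
(* After multiplying by [eta]: k eta + 2k + eta <= k/4 + 2k + 4k <= 8k, because eta <= 1/4 and eta <
   4k. *)
rewrite -(ler_pM2r eta0).
have -> : (k * (1 + 2 / eta) + 1) * eta = k * eta + 2 * k + eta by field; rewrite gt_eqF.
have -> : 8 / eta * k * eta = 8 * k by field; rewrite gt_eqF.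
by nra.
Qed.

End Semisolid.

(** * Growth functions and restrictions of homeomorphisms *)

Section GrowthFunction.
Context {R : realType}.
Implicit Types (phi : R -> R) (s t : R).

(** Expansion gives injectivity, [t <= phi t], and a 1-Lipschitz inverse; surjectivity onto [v] is
    the intermediate value theorem on [0, v], as phi 0 = 0 and phi v >= v. *)
Lemma growth_function_of_expanding phi : {within `[0, +oo[, continuous phi} ->
  phi 0 = 0 -> (forall s t, 0 <= s -> s <= t -> t - s <= phi t - phi s) ->
  growth_function phi.
Proof.
move=> pc p0 pe.
have pge t : 0 <= t -> t <= phi t by move=> t0; have := pe 0 t (lexx 0) t0; rewrite p0 !subr0.
have bij : set_bij `[0, +oo[ `[0, +oo[ phi.
  split.
  - by move=> t /=; rewrite !in_itv/= !andbT => t0; exact: le_trans (pge t t0).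
  - move=> s t; rewrite !inE/= !in_itv/= !andbT.
    wlog st : s t / s <= t => [W s0 t0 E|s0 t0 E].
      by have [|/ltW] := leP s t => ?; [exact: W|apply/esym; exact: W].
    by have := pe s t s0 st; rewrite E subrr subr_le0 => ts; apply/le_anti; rewrite st.
  - move=> v /=; rewrite in_itv/= andbT => v0.
    have vc : {within `[0, v], continuous phi}.
      apply: continuous_subspaceW pc => t /=.
      by rewrite !in_itv/= => /andP[-> _].
    have pv := pge v v0.
    have [|t] := IVT v0 vc (v := v).
      by rewrite p0 (min_idPl (le_trans v0 pv)) (max_idPr (le_trans v0 pv)) v0.
    by rewrite in_itv/= => /andP[t0 _] tv; exists t; rewrite //= in_itv/= t0.
split => //; split => //; have [_ _ surj] := bij.
have inv v : 0 <= v -> 0 <= growth_inv phi v /\ phi (growth_inv phi v) = v.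
  move=> v0; have vin : v \in (`[0, +oo[%classic : set R) by rewrite inE /= in_itv/= v0.
  split; last exact: (surjpK _ surj).
  have : [set` `[0, +oo[] (growth_inv phi v).
    by apply: (surjpinv_image_sub surj); exists v; rewrite //= in_itv/= v0.
  by rewrite /= in_itv/= andbT.
apply/within_continuousP => u /= + e e0; rewrite in_itv/= andbT => u0.
exists e => // v; rewrite in_itv/= andbT => v0; apply: le_lt_trans.
have [iu0 iuE] := inv u u0; have [iv0 ivE] := inv v v0.
rewrite -/(growth_inv phi u) -/(growth_inv phi v).
wlog uv : u v u0 v0 iu0 iuE iv0 ivE / growth_inv phi u <= growth_inv phi v.
  move=> W; have [|/ltW] := leP (growth_inv phi u) (growth_inv phi v); first exact: W.
  by rewrite distrC (distrC u); exact: W.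
have := pe _ _ iu0 uv; rewrite iuE ivE => le.
rewrite distrC ger0_norm ?subr_ge0// (le_trans le)//.
by rewrite distrC ler_norm.
Qed.

Section Facts.
Variable phi : R -> R.
Hypothesis hphi : growth_function phi.

Lemma growth_function0 : phi 0 = 0.
Proof.
have [[[_ _ surj] _ _] pge] := hphi.
have [t] : (phi @` `[0, +oo[) 0 by apply: surj; rewrite /= in_itv/= lexx.
rewrite /= in_itv/= andbT => t0 pt0; have := pge t t0; rewrite pt0 => t0'.
by move: pt0; rewrite (_ : t = 0)//; apply/le_anti; rewrite t0' t0.
Qed.

Lemma growth_function_le s t : 0 <= s -> 0 <= t -> (phi s <= phi t) = (s <= t).
Proof.
have [[[_ inj _] pc _] pge] := hphi => s0 t0.
have := @itv_continuous_inj_le R phi `[0, +oo[; apply => //; rewrite ?in_itv/= ?s0 ?t0//.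
(* A continuous injection of an interval is monotone; phi 0 = 0 <= phi 1 selects the increasing
   case. *)
- exists 0, 1; rewrite !in_itv/= lexx ler01 ltr01 growth_function0; split => //.
  by apply: le_trans (pge 1 _).
- by move=> u v uI vI; apply: inj; rewrite inE.
Qed.

Lemma growth_function_ge0 t : 0 <= t -> 0 <= phi t.
Proof. by move=> t0; have [_ pge] := hphi; exact: le_trans (pge t t0). Qed.

Lemma growth_invK t : 0 <= t -> 0 <= growth_inv phi t /\ phi (growth_inv phi t) = t.
Proof.
have [[[_ _ surj] _ _] _] := hphi => v0.
have vin : t \in (`[0, +oo[%classic : set R) by rewrite inE /= in_itv/= v0.
split; last exact: (surjpK _ surj).
have : [set` `[0, +oo[] (growth_inv phi t).
  by apply: (surjpinv_image_sub surj); exists t; rewrite //= in_itv/= v0.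
by rewrite /= in_itv/= andbT.
Qed.

Lemma growth_inv_le s t : 0 <= s -> 0 <= t -> growth_inv phi s <= t -> s <= phi t.
Proof.
move=> s0 t0; have [i0 iE] := growth_invK s0.
by rewrite -growth_function_le// iE.
Qed.

Lemma growth_function_scale (c : R) : 1 <= c ->
  growth_function (fun t => 4 * phi (4 * t) + c * t).
Proof.
move=> c1; apply: growth_function_of_expanding.
- have [[_ pc _] _] := hphi; apply/within_continuousP => x /= + e e0.
  rewrite in_itv/= andbT => x0.
  have x40 : (`[0, +oo[%classic : set R) (4 * x) by rewrite /= in_itv/= mulr_ge0.
  have e8 : 0 < e / 8 by rewrite divr_gt0.
  have [d d0 dP] := (within_continuousP _ _).1 pc _ x40 _ e8.
  have c0 : 0 < c by exact: lt_le_trans c1.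
  (* The two terms contribute at most 4 (e/8) and c e / (2c), each equal to e/2. *)
  exists (Num.min (d / 4) (e / (2 * c))); first by rewrite lt_min !divr_gt0// mulr_gt0.
  move=> y; rewrite in_itv/= andbT lt_min => y0 /andP[xyd].
  rewrite ltr_pdivlMr ?mulr_gt0// => xye.
  have y40 : (`[0, +oo[%classic : set R) (4 * y) by rewrite /= in_itv/= mulr_ge0.
  have : `|phi (4 * x) - phi (4 * y)| < e / 8.
    by apply: dP => //; rewrite -mulrBr normrM gtr0_norm//; lra.
  rewrite opprD addrACA -!mulrBr => pe.
  apply: le_lt_trans (ler_normD _ _) _.
  by rewrite !normrM (gtr0_norm c0) (ger0_norm (ler0n R 4)); lra.
- by rewrite !mulr0 growth_function0 mulr0 addr0.
move=> s t s0 st.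
have : phi (4 * s) <= phi (4 * t) by rewrite growth_function_le ?ler_pM2l ?mulr_ge0// (le_trans s0).
have : t - s <= c * (t - s) by rewrite ler_peMl// subr_ge0.
lra.
Qed.

End Facts.
End GrowthFunction.

(** * Restriction of a homeomorphism to a subdomain *)

Section RestrictHomeo.
Context {R : realType} {E F : completeNormedModType R}.
Variables (D : set E) (D' : set F) (f : E -> F) (D1 : set E).
Hypotheses (hf : homeo_on D D' f) (D1D : D1 `<=` D).

Lemma homeo_on_pinv_restrict x : D1 x -> pinv D f (f x) = x.
Proof.
have [[_ inj _] _ _] := hf => D1x.
by rewrite pinvKV// inE; exact: D1D.
Qed.

(** [pinv D1 f] and [pinv D f] may differ as total functions but agree on the image of D1, which
    transfers continuity of the inverse. *)
Lemma homeo_on_restrict : homeo_on D1 (f @` D1) f.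
Proof.
have [[fD inj surj] fc ic] := hf.
have inj1 : {in D1 &, injective f}.
  by move=> x y; rewrite !inE => D1x D1y; apply: inj; rewrite inE; exact: D1D.
split.
- by split.
- exact: continuous_subspaceW fc.
apply: (@subspace_eq_continuous _ _ _ (pinv D f)); last first.
  by apply: continuous_subspaceW ic => _ [x /D1D Dx <-]; exact: fD.
move=> _ /set_mem[x D1x <-]; rewrite /from_subspace homeo_on_pinv_restrict//.
by rewrite pinvKV// inE.
Qed.

(** Invariance of domain fails in infinite dimension; openness comes instead from continuity of the
    inverse on the open set D'. *)
Lemma homeo_on_image_open : open D' -> open D1 -> open (f @` D1).
Proof.
have [[fD inj surj] fc ic] := hf => oD' oD1.
apply: norm_ball_open => _ [x D1x <-].
have D'fx : D' (f x) by apply: fD; exact: D1D.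
have [e e0 eD1] := open_norm_ball oD1 D1x.
have [d d0 dD'] := open_norm_ball oD' D'fx.
have [r r0 rP] := (within_continuousP _ _).1 ic _ D'fx e e0.
exists (Num.min d r); first by rewrite lt_min d0.
move=> y; rewrite lt_min => /andP[yd yr].
have D'y := dD' y yd; exists (pinv D f y).
  apply: eD1; have := rP y D'y yr.
  by rewrite /from_subspace homeo_on_pinv_restrict.
by apply: (surjpK _ surj); rewrite inE.
Qed.

Lemma homeo_on_image_domain : open D' -> domain D1 -> domain (f @` D1).
Proof.
have [_ fc _] := hf => oD' [[x D1x] oD1 cD1]; split.
- by exists (f x), x.
- exact: homeo_on_image_open.
apply: connected_continuous_connected => //; exact: continuous_subspaceW fc.
Qed.

Lemma homeo_on_image_neqT : (D <> setT -> D' <> setT) -> (D = setT -> D1 <> setT) ->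
  f @` D1 <> setT.
Proof.
have [[fD inj surj] _ _] := hf => DD' DD1 fT.
(* If D is proper, the image lies in the proper subset D'; if D is the whole space, injectivity
   would turn a full image into a full D1. *)
have [DT|/DD'] := pselect (D = setT); last first.
  apply; rewrite -subTset -fT => _ [x /D1D Dx <-]; exact: fD.
apply: (DD1 DT); rewrite -subTset => x _.
have [y D1y fyx] : (f @` D1) (f x) by rewrite fT.
by rewrite -(inj y x)// inE ?DT//.
Qed.

End RestrictHomeo.
Unset Implicit Arguments.

Theorem theorem3 (R : realType) (phi : R -> R) (hphi : growth_function phi) :
  exists phi1 : R -> R, growth_function phi1 /\
    forall (E E' : completeNormedModType R),
      dim_ge2 E -> dim_ge2 E' ->
    forall (D : set E) (D' : set E') (f : E -> E'),
      domain D -> domain D' -> (D <> setT -> D' <> setT) ->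
      homeo_on D D' f ->
      (forall D1 : set E,
         domain D1 -> D1 `<=` D -> (D = setT -> D1 <> setT) ->
         forall x y : E, D1 x -> D1 y ->
           growth_inv phi (jmetric D1 x y) <= jmetric (f @` D1) (f x) (f y) /\
           jmetric (f @` D1) (f x) (f y) <= phi (jmetric D1 x y)) ->
      FQC phi1 D D' f.
Proof.
have [[_ _ _] pge] := hphi.
have q0 : 0 <= 1 / 4 :> R by rewrite divr_ge0.
have [e0 eE] := growth_invK hphi q0.
set eta := growth_inv phi (1 / 4) in e0 eE.
have eta4 : eta <= 1 / 4 by rewrite -[leRHS]eE pge.
have eta0 : 0 < eta.
  rewrite lt_neqAle e0 andbT; apply/eqP => e; move: eE; rewrite -e growth_function0//; lra.
have phieta : phi eta <= 1 / 4 by rewrite eE.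
have phi_le s t : 0 <= s -> s <= t -> phi s <= phi t.
  by move=> s0 st; rewrite growth_function_le// (le_trans s0).
exists (fun t => 4 * phi (4 * t) + 8 / eta * t); split.
  by apply: growth_function_scale => //; rewrite ler_pdivlMr//; lra.
move=> E E' _ _ D D' f dD [_ oD' _] DD' hf hj; split => // D1 dD1 D1D DD1.
have [_ surj] : set_inj D1 f /\ set_surj D1 (f @` D1) f.
  by have [[]] := homeo_on_restrict hf D1D.
have D1T : D1 <> setT.
  by move=> D1T; apply: DD1 (D1T); rewrite -subTset -D1T.
have dfD1 := homeo_on_image_domain hf D1D oD' dD1.
have fD1T := homeo_on_image_neqT hf D1D DD' DD1.
have fD1 x : D1 x -> (f @` D1) (f x) by exists x.
have pD1 y : (f @` D1) y -> D1 (pinv D1 f y) /\ f (pinv D1 f y) = y.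
  move=> fy; split; last by apply: (surjpK _ surj); rewrite inE.
  by apply: (surjpinv_image_sub surj); exists y.
have phi_ge0 t : 0 <= t -> 0 <= phi t by exact: growth_function_ge0.
split; [by split|by split|exact: (homeo_on_restrict hf)| |].
- apply: semisolid_of_jmetric => // x y D1x D1y.
  by have [] := hj D1 dD1 D1D DD1 x y D1x D1y.
(* The inverse satisfies the same bound with the same [phi], by [growth_inv_le], so [eta] and phi1
   do not change. *)
- apply: semisolid_of_jmetric => // [y fy|x y fx fy]; first by have [] := pD1 y fy.
  have [D1x fxE] := pD1 x fx; have [D1y fyE] := pD1 y fy.
  have [le _] := hj D1 dD1 D1D DD1 _ _ D1x D1y; rewrite fxE fyE in le.
  by apply: (growth_inv_le hphi) le; exact: jmetric_ge0.
Qed.
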